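(* Let $d\in\mathbb{N}$ and let $\mathbf{Z}$ be an $\mathbb{R}^d$-valued random vector that is regularly varying on the cone $\mathbb{E}^d=(0,\infty)^d$ with index $-\alpha$ for some $\alpha>0$ and limit measure $\nu$. Moreover, let $\mathbf{A}$ be a random matrix with values in $\mathbb{R}^{d\times d}$, independent of $\mathbf{Z}$, which satisfies $\tau(\mathbf{A})>0$ almost surely and $E(\tau(\mathbf{A})^{\alpha+\delta})<\infty$ for some $\delta>0$. Then $$\lim_{x\to\infty}\frac{P(\mathbf{A}\mathbf{Z}\in xB)}{P(\min(\mathbf{Z})>x)}=E\bigl(\nu(\mathbf{A}^{-1}B)\bigr)<\infty$$ for all Borel sets $B\subset\mathbb{E}^d$ bounded away from $\mathcal{O}^d=\partial(\mathbb{E}^d)$ with $E(\nu(\partial(\mathbf{A}^{-1}B)))=0$. In particular, $\mathbf{A}\mathbf{Z}$ is regularly varying on $\mathbb{E}^d$ with index $-\alpha$ and limiting measure $$B\mapsto\frac{E(\nu(\mathbf{A}^{-1}B))}{E(\nu(\mathbf{A}^{-1}((1,\infty)^d)))}.$$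
   Context: Notation: $\mathbb{E}^d:=(0,\infty)^d$, $\mathcal{O}^d:=\partial(\mathbb{E}^d)=\{\mathbf{x}\in[0,\infty)^d:\min(\mathbf{x})=0\}$, where $\min(\mathbf{z}):=\min\{z_1,\dots,z_d\}$ for $\mathbf{z}\in\mathbb{R}^d$; $\partial B$ denotes the topological boundary of $B$. Regular variation on $\mathbb{E}^d$: an $\mathbb{R}^d$-valued random vector $\mathbf{Z}$ is regularly varying on the cone $\mathbb{E}^d$ with limit measure $\nu$ if $\nu\neq 0$ is a measure on $\mathcal{B}(\mathbb{E}^d)$, finite on $(x,\infty)^d$ for all $x>0$, such that $P(\mathbf{Z}\in xB)/P(\min(\mathbf{Z})>x)\to\nu(B)$ as $x\to\infty$ for all Borel sets $B\subset\mathbb{E}^d$ that are bounded away from $\mathcal{O}^d$ and satisfy $\nu(\partial B)=0$. The measure $\nu$ is then necessarily homogeneous of some order $-\alpha<0$, i.e. $\nu(tB)=t^{-\alpha}\nu(B)$ for $t>0$, and $-\alpha$ is called the index of regular variation on $\mathbb{E}^d$. The function $\tau$: for $\mathbf{x}\in\mathbb{R}^d$, $\tau(\mathbf{x}):=\min(\mathbf{x}^+)$ with $\mathbf{x}^+=(\max\{x_1,0\},\dots,\max\{x_d,0\})$. Let $\mathcal{S}^d:=\{\mathbf{x}\in\mathbb{E}^d:\tau(\mathbf{x})=1\}$. For $\mathbf{A}\in\mathbb{R}^{d\times d}$, $\tau(\mathbf{A}):=\sup_{\mathbf{x}\in\mathcal{S}^d}\tau(\mathbf{A}\mathbf{x})\in[0,\infty]$.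 $\mathbf{A}^{-1}B$ denotes the preimage $\{\mathbf{x}\in\mathbb{R}^d:\mathbf{A}\mathbf{x}\in B\}$; if $0<\tau(\mathbf{A})<\infty$ then $\mathbf{A}$ is invertible and $\mathbf{A}^{-1}(\mathbb{E}^d)\subset\mathbb{E}^d$.
   Formalization: The ''in particular'' claim is stated only when E(ν(A^{-1}((1,∞)^d))) is nonzero; otherwise the displayed limiting measure is 0/0 and AZ need not be regularly varying, e.g. Z=(W,W) with W Pareto and A=[[-1,3],[1,-2]]. *)

(* Defs.v *)
From HB Require Import structures.
From mathcomp Require Import all_boot all_order all_algebra.
From mathcomp Require Import all_classical all_reals all_analysis.

Set Implicit Arguments.
Unset Strict Implicit.
Unset Printing Implicit Defensive.

Import Order.TTheory GRing.Theory Num.Theory.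
Import numFieldNormedType.Exports.

Local Open Scope classical_set_scope.
Local Open Scope ring_scope.

Definition borel (T : ptopologicalType) := g_sigma_algebraType (@open T).

Definition boundary (T : topologicalType) (B : set T) : set T :=
  closure B `\` B°.

(* The dimension [d], at least 1, is [n.+1] throughout, so that minima over
   the coordinates make sense. *)
Section Orthant.
Context {R : realType} {n : nat}.
Implicit Types (x z : 'cV[R]_n.+1) (B : set 'cV[R]_n.+1).

(* The initial value [z ord0 ord0] is one of the coordinates, so it does not
   affect the minimum. *)
Definition minv z : R := \big[Order.min/z ord0 ord0]_(i < n.+1) z i ord0.

Definition posv x : 'cV[R]_n.+1 := \col_i Order.max (x i ord0) 0.

Definition tau x : R := minv (posv x).

Definition upper_orthant (a : R) : set 'cV[R]_n.+1 :=
  [set z | forall i, a < z i ord0].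

Definition orthant : set 'cV[R]_n.+1 := upper_orthant 0.

Definition tau_sphere : set 'cV[R]_n.+1 := [set x | orthant x /\ tau x = 1].

Definition tau_mx (M : 'M[R]_n.+1) : \bar R :=
  ereal_sup [set (tau (M *m x))%:E | x in tau_sphere].

Definition scale_set (t : R) B : set 'cV[R]_n.+1 := [set t *: z | z in B].

Definition preim_mx (M : 'M[R]_n.+1) B : set 'cV[R]_n.+1 :=
  [set x | B (M *m x)].

Definition bounded_away_boundary B :=
  exists2 e : R, 0 < e &
    forall x y, B x -> boundary orthant y -> e <= `|x - y|.

(* A measure on the Borel sets of the orthant is encoded by its extension by
   zero to the Borel sets of the whole space. *)
Definition orthant_measure
    (nu : {measure set (borel 'cV[R]_n.+1) -> \bar R}) :=
  nu (~` orthant) = 0%E.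

Definition homogeneous (nu : {measure set (borel 'cV[R]_n.+1) -> \bar R})
    (k : R) :=
  forall (t : R) (B : set (borel 'cV[R]_n.+1)),
    0 < t -> measurable B -> B `<=` orthant ->
    nu (scale_set t B) = ((t `^ k)%:E * nu B)%E.

End Orthant.

Section RegularVariation.
Context {R : realType} {disp : measure_display} {T : measurableType disp}.
Context (P : probability T R) {n : nat}.

(* The quotients are taken in the extended reals, where [0 / 0 = 0]; for a
   nonzero [nu] the limit condition forces all [P (min X > x)] to be
   positive. *)
Definition regularly_varying (X : T -> borel 'cV[R]_n.+1)
    (nu : {measure set (borel 'cV[R]_n.+1) -> \bar R}) :=
  [/\ measurable_fun setT X,
      orthant_measure nu,
      nu orthant != 0%E,
      (forall x : R, 0 < x -> (nu (upper_orthant x) < +oo)%E) &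
      forall B : set (borel 'cV[R]_n.+1),
        measurable B -> B `<=` orthant -> bounded_away_boundary B ->
        nu (boundary (B : set 'cV[R]_n.+1)) = 0%E ->
        (P [set w | scale_set x B (X w)] / P [set w | x < minv (X w)]%R)%E
          @[x --> +oo] --> nu B].

(* [k] is the order of homogeneity of [nu], e.g. [- alpha]. *)
Definition regularly_varying_index (X : T -> borel 'cV[R]_n.+1)
    (nu : {measure set (borel 'cV[R]_n.+1) -> \bar R}) (k : R) :=
  regularly_varying X nu /\ homogeneous nu k.

Definition independent_rv {d1 d2 : measure_display} {T1 : measurableType d1}
    {T2 : measurableType d2} (X : {RV P >-> T1}) (Y : {RV P >-> T2}) :=
  forall (U : set T1) (V : set T2), measurable U -> measurable V ->
    P (X @^-1` U `&` Y @^-1` V) = (P (X @^-1` U) * P (Y @^-1` V))%E.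

Definition mean_preim (M : T -> borel 'M[R]_n.+1)
    (nu : {measure set (borel 'cV[R]_n.+1) -> \bar R})
    (B : set 'cV[R]_n.+1) : \bar R :=
  \int[P]_w nu (preim_mx (M w) B).

End RegularVariation.

(* Main.v *)
Require Import Defs.
From HB Require Import structures.
From mathcomp Require Import all_boot all_order all_algebra.
From mathcomp Require Import all_classical all_reals all_analysis.
From mathcomp Require Import measurable_realfun ring lra.

(** The vector [A Z] lies in [x B] iff [Z] lies in [x A^-1 B].  If
    [0 < tau A < oo] then [A] is invertible and maps no point outside the
    orthant into it, and [A^-1 B] stays away from the boundary: [B] in
    [{min > e}] gives [A^-1 B] in [{min > e / tau A}].  Conditionally on [A] (Fubini, by
    independence) the quotient therefore converges to [nu (A^-1 B)] by regular
    variation of [Z].  It is at most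
    [P (min Z > x e / tau A) / P (min Z > x)], which a Potter bound dominates by
    [K (1 + (tau A / e) ^ (alpha + delta))] uniformly in large [x], so dominated
    convergence applies. *)

Set Implicit Arguments.
Unset Strict Implicit.
Unset Printing Implicit Defensive.

Import Order.TTheory GRing.Theory Num.Theory.
Import numFieldNormedType.Exports.

Local Open Scope classical_set_scope.
Local Open Scope ring_scope.

(** On a null event [A w] may be singular or have infinite [tau_mx], so pointwise facts are used
    only where [0 < tau_mx (A w) < +oo]; finiteness there comes from the moment hypothesis. This
    shapes the treatment of the boundary condition: [nu (boundary (preim_mx (A w) B))] is not known
    to be measurable in [w], but on that event boundary and preimage commute, which gives a
    measurable substitute.

    The moment is of order strictly above [alpha] because a Potter bound needs an exponent above the
    index.

    For the second claim, the first limit applied to (1, oo)^d compares P(min(AZ) > x) with P(min Z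
    > x), and a quotient of two limits remains. The limit measure is a multiple of the image of P x
    nu under (w, z) -> A(w) z, restricted to the orthant. Its normaliser has to be assumed nonzero:
    A^-1 of the orthant can miss all the mass of nu, for instance when nu lives on a ray outside
    this cone. *)

(** * Minima, [tau_mx] and preimages of orthants under matrices *)

Section Geometry.
Context {R : realType}.

Lemma continuous_mx (S : topologicalType) m k (f : S -> 'M[R]_(m, k)) :
  (forall i j, continuous (fun x => f x i j)) -> continuous f.
Proof.
move=> cf x B [Q nQ QB]; apply: (@filterS _ (nbhs x) _
  [set y | forall i j, Q i j (f y i j)]) => [y Qy|]; first exact: QB.
by apply: filter_forall => i; apply: filter_forall => j; exact: cf.
Qed.

Lemma continuous_sum (S : topologicalType) (I : Type) (r : seq I)
    (f : I -> S -> R) :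
  (forall i, continuous (f i)) -> continuous (fun x => \sum_(i <- r) f i x).
Proof.
move=> cf x; elim: r => [|i r IH].
  by under eq_fun do rewrite big_nil; exact: cvg_cst.
under eq_fun do rewrite big_cons.
by apply: cvgD => //; exact: cf.
Qed.

Lemma continuous_mulmx m k l (M : 'M[R]_(m, k)) :
  continuous (mulmx M : 'M[R]_(k, l) -> _).
Proof.
apply: continuous_mx => i j.
under eq_fun do rewrite mxE.
apply: continuous_sum => u x.
have h := @coord_continuous R k l u j x.
exact: (@cvgMl_tmp R 'M[R]_(k, l) (nbhs x) _ _ (M i u) _ h).
Qed.

Context {n : nat}.
Implicit Types (x z : 'cV[R]_n.+1) (M : 'M[R]_n.+1) (B : set 'cV[R]_n.+1).

Lemma minv_gtP a z : reflect (upper_orthant a z) (a < minv z).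
Proof.
apply: (iffP (bigmin_gtP _ _ _ _)) => [[_ h] i|h]; first exact: h.
by split=> [|i _]; [exact: h ord0|exact: h].
Qed.

Lemma minv_gtE a : [set z | a < minv z] = @upper_orthant R n a.
Proof. by apply/seteqP; split=> z /= /minv_gtP. Qed.

Lemma minv_le z i : minv z <= z i ord0.
Proof. exact: bigmin_le. Qed.

Lemma minv_ex z : exists i, minv z = z i ord0.
Proof.
rewrite /minv; elim/big_ind: _ => [|a b [i ->] [j ->]|i _]; last by exists i.
- by exists ord0.
- by case: (leP (z i ord0) (z j ord0)) => _; [exists i|exists j].
Qed.

Lemma posv_id z : orthant z -> posv z = z.
Proof.
by move=> z0; apply/colP => i; rewrite mxE max_l// ltW//; exact: z0.
Qed.

Lemma minvZ t z : 0 <= t -> minv (t *: z) = t * minv z.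
Proof.
move=> t0; have [i zi] := minv_ex z; have [j tzj] := minv_ex (t *: z).
apply/eqP; rewrite eq_le; apply/andP; split.
  by rewrite zi; have := minv_le (t *: z) i; rewrite mxE.
by rewrite tzj mxE ler_wpM2l// minv_le.
Qed.

Lemma posvZ t z : 0 <= t -> posv (t *: z) = t *: posv z.
Proof. by move=> t0; apply/colP => i; rewrite !mxE maxr_pMr// mulr0. Qed.

Lemma tau_gtP a z : 0 <= a -> reflect (upper_orthant a z) (a < tau z).
Proof.
move=> a0; apply: (iffP (minv_gtP _ _)) => h i; move: (h i); rewrite mxE lt_max.
  by rewrite [a < 0]ltNge a0 orbF.
by move=> ->.
Qed.

Lemma upper_orthantS a b : a <= b -> @upper_orthant R n b `<=` upper_orthant a.
Proof. by move=> ab z h i; exact: le_lt_trans ab (h i). Qed.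

Lemma upper_orthantZ t a z : 0 < t ->
  upper_orthant (t * a) (t *: z) <-> upper_orthant a z.
Proof.
by move=> t0; split=> h i; move: (h i); rewrite mxE ltr_pM2l.
Qed.

Lemma scale_setE t B : 0 < t -> scale_set t B = [set z | B (t^-1 *: z)].
Proof.
move=> t0; apply/seteqP; split=> [_ [z Bz <-]|z Bz] /=.
  by rewrite scalerA mulVf ?gt_eqF// scale1r.
by exists (t^-1 *: z) => //; rewrite scalerA divff ?gt_eqF// scale1r.
Qed.

Lemma scale_upper_orthant t a : 0 < t ->
  scale_set t (@upper_orthant R n a) = upper_orthant (t * a).
Proof.
move=> t0; rewrite scale_setE//; apply/seteqP; split=> z /= uz.
  rewrite -[z](scale1r) -(divff (lt0r_neq0 t0)) -scalerA.
  exact/upper_orthantZ.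
by apply/(upper_orthantZ _ _ t0); rewrite scalerA divff ?gt_eqF// scale1r.
Qed.

(** Dividing [x] by its minimum puts it on [tau_sphere], and [tau] is positively homogeneous. *)
Lemma tau_mx_bound M x : 0 < minv x ->
  ((tau (M *m x))%:E <= tau_mx M * (minv x)%:E)%E.
Proof.
move=> x0; have xo : orthant x by exact/minv_gtP.
rewrite -lee_pdivrMr//; apply: ereal_sup_ubound => /=.
exists ((minv x)^-1 *: x).
  have ox : orthant ((minv x)^-1 *: x).
    by move=> i; rewrite mxE mulr_gt0 ?invr_gt0//; exact: xo.
  split => //; rewrite /tau posv_id// minvZ ?invr_ge0 ?ltW//.
  by rewrite mulVf// gt_eqF.
rewrite /tau -scalemxAr posvZ ?invr_ge0 ?ltW// minvZ ?invr_ge0 ?ltW//.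
by rewrite mulrC EFinM.
Qed.

Lemma tau_mx_gt0_ex M : (0 < tau_mx M)%E ->
  exists2 x, orthant x & orthant (M *m x).
Proof.
move=> /ereal_sup_gt [_ [x [ox _] <-]]; rewrite lte_fin => Mx.
by exists x => //; exact/(tau_gtP _ (lexx 0)).
Qed.

(** The intersection with the orthant is explicit because [preim_orthant], which removes it, is
    itself proved from this version. *)
Lemma preim_upper_orthantI M (t c : R) : (tau_mx M <= t%:E)%E -> 0 < t ->
  0 <= c -> orthant `&` preim_mx M (upper_orthant c) `<=` upper_orthant (c / t).
Proof.
move=> Mt t0 c0 x [ox Mx]; have x0 : 0 < minv x by exact/minv_gtP.
apply/minv_gtP; rewrite ltr_pdivrMr// -lte_fin.
have : (c < tau (M *m x))%R by exact/tau_gtP.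
rewrite -lte_fin => /lt_le_trans; apply.
apply: (le_trans (tau_mx_bound M x0)).
by rewrite mulrC EFinM lee_wpmul2r// lee_fin ltW.
Qed.

Lemma continuous_minv : continuous (@minv R n).
Proof.
move=> x; apply/(@cvgrPdist_lt R _ _ _ (nbhs_filter x)) => e e0; near=> y.
have h : forall i, `|x i ord0 - y i ord0| < e.
  near: y; apply: (@filter_forall _ _ _ _ (nbhs_filter x)) => i.
  have c := @coord_continuous R n.+1 1 i ord0 x.
  exact: (proj1 (@cvgrPdist_lt R _ _ _ (nbhs_filter x) _ _) c e e0).
have [i xi] := minv_ex x; have [j yj] := minv_ex y.
have := minv_le x j; have := minv_le y i.
have := h i; have := h j; rewrite xi yj !ltr_norml => /andP[? ?] /andP[? ?] ? ?.
by apply/andP; split; lra.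
Unshelve. all: by end_near. Qed.

(* On a segment from an interior point to [z], the minimum would have to cross
   small positive values, which [tau_mx_bound] forbids. *)
Lemma preim_orthant M : (0 < tau_mx M < +oo)%E ->
  preim_mx M orthant `<=` orthant.
Proof.
move=> /andP[M0 Moo] z Mz.
have [x ox Mx] := tau_mx_gt0_ex M0.
have [t t0 tE] : exists2 t, 0 < t & tau_mx M = t%:E.
  by case: (tau_mx M) M0 Moo => // r; rewrite lte_fin => r0 _; exists r.
apply/minv_gtP; rewrite ltNge; apply/negP => z0.
pose y (s : R) : 'cV[R]_n.+1 := x + s *: (z - x).
pose c : R := Num.min (minv (M *m x)) (minv (M *m z)) / 2.
have x0 : 0 < minv x by exact/minv_gtP.
have c0 : 0 < c.
  by rewrite divr_gt0// lt_min; apply/andP; split; exact/minv_gtP.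
have cx i : c < (M *m x) i ord0.
  have := minv_le (M *m x) i; have : 0 < minv (M *m x) by exact/minv_gtP.
  have : 2 * c <= minv (M *m x) by rewrite mulrC divfK// ge_min lexx.
  by lra.
have cz i : c < (M *m z) i ord0.
  have := minv_le (M *m z) i; have : 0 < minv (M *m z) by exact/minv_gtP.
  have : 2 * c <= minv (M *m z) by rewrite mulrC divfK// ge_min lexx orbT.
  by lra.
(* The level [b / 2] lies between [minv z <= 0] and [minv x], so the segment attains it, yet below
   [c / t], which must be exceeded at any point of the orthant whose image has all coordinates above
   [c]. *)
pose b := Num.min (minv x) (c / t).
have b0 : 0 < b by rewrite lt_min x0 divr_gt0.
have [s] : exists2 s, s \in `[0, 1] & minv (y s) = b / 2.
  apply: IVT => //.
    apply: continuous_subspaceT => s.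
    apply: (@continuous_comp _ _ _ y (@minv R n)); last exact: continuous_minv.
    apply: continuous_mx => i j {}s.
    under eq_fun do rewrite !mxE.
    by apply: cvgD; [exact: cvg_cst|apply: cvgMr_tmp; exact: cvg_id].
  rewrite /y scale0r scale1r addr0 addrC subrK.
  have bx : b <= minv x by rewrite ge_min lexx.
  by rewrite ge_min le_max; apply/andP; split; apply/orP; [right|left]; lra.
rewrite in_itv/= => /andP[s0 s1] ys.
have ys0 : orthant (y s) by apply/minv_gtP; rewrite ys; lra.
have tE' : (tau_mx M <= t%:E)%E by rewrite tE.
have : upper_orthant (c / t) (y s).
  apply: (preim_upper_orthantI tE' t0 (ltW c0)).
  split=> // i; rewrite mulmxDr -scalemxAr mulmxBr.
  have := cx i; have := cz i; move: (M *m x) (M *m z) => Mx' Mz'.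
  rewrite !mxE; set u := Mx' i ord0; set v := Mz' i ord0.
  move=> hv hu.
  suff : 0 < (1 - s) * (u - c) + s * (v - c) by lra.
  have [->|s_neq0] := eqVneq s 0; first by lra.
  rewrite ltr_wpDl//; first by apply: mulr_ge0; lra.
  by apply: mulr_gt0; [rewrite lt_neqAle eq_sym s_neq0|lra].
have [i yi] := minv_ex (y s).
move=> /(_ i); rewrite -yi ys.
have : b <= c / t by rewrite ge_min lexx orbT.
by lra.
Qed.

Lemma preim_upper_orthant M (t c : R) : tau_mx M = t%:E -> 0 < t ->
  0 <= c -> preim_mx M (upper_orthant c) `<=` upper_orthant (c / t).
Proof.
move=> Mt t0 c0 x Mx; apply: (@preim_upper_orthantI M) => //.
  by rewrite Mt.
split=> //; apply: (@preim_orthant M).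
  by rewrite Mt lte_fin t0 ltry.
exact: upper_orthantS c0 _ Mx.
Qed.

(** A kernel vector would give a whole line through an interior point with constant image in the
    orthant. By [preim_orthant] the line stays in the orthant, but one of its coordinates vanishes
    somewhere. *)
Lemma tau_mx_unit M : (0 < tau_mx M < +oo)%E -> M \in unitmx.
Proof.
move=> Moo; rewrite -unitmx_tr -row_free_unit -kermx_eq0.
apply/rowV0P => v /sub_kermxP vM.
have {vM}Mv : M *m v^T = 0 by rewrite -[M]trmxK -trmx_mul vM trmx0.
have [x ox Mx] : exists2 x, orthant x & orthant (M *m x).
  by apply: tau_mx_gt0_ex; case/andP: Moo.
have xv s : orthant (x + s *: v^T).
  apply: (preim_orthant Moo).
  by rewrite /preim_mx/= mulmxDr -scalemxAr Mv scaler0 addr0.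
apply/rowP => j; rewrite mxE; apply/eqP/negPn/negP => vj.
have := xv (- x j ord0 / v ord0 j) j.
by rewrite !mxE divfK// subrr ltxx.
Qed.

End Geometry.

(** * Boundaries of preimages and distance from the boundary of the orthant *)

Section Topology.
Context {R : realType} {n : nat}.
Implicit Types (x z : 'cV[R]_n.+1) (M : 'M[R]_n.+1) (B : set 'cV[R]_n.+1).

Lemma continuous_preimage_closure (S S' : topologicalType) (f : S -> S')
    (B : set S') : continuous f -> closure (f @^-1` B) `<=` f @^-1` closure B.
Proof.
by move=> cf x clx C fC; have [y [? ?]] := clx _ (cf x _ fC); exists (f y).
Qed.

(** Continuity of [M] gives one inclusion, that of its inverse the other. *)
Lemma closure_preim_mx M B : M \in unitmx ->
  closure (preim_mx M B) = preim_mx M (closure B).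
Proof.
move=> uM; apply/seteqP; split=> x /=.
  exact: (continuous_preimage_closure (@continuous_mulmx R _ _ _ M)).
have {1}-> : B = mulmx (invmx M) @^-1` preim_mx M B.
  by apply/seteqP; split=> y; rewrite /preim_mx/= mulKVmx.
move=> /(continuous_preimage_closure (@continuous_mulmx R _ _ _ (invmx M))).
by rewrite /preim_mx/= mulKmx.
Qed.

Lemma interiorE (S : topologicalType) (B : set S) : B° = ~` closure (~` B).
Proof. by rewrite -interiorC setCK. Qed.

Lemma boundary_preim_mx M B : M \in unitmx ->
  boundary (preim_mx M B) = preim_mx M (boundary B).
Proof.
move=> uM; rewrite /boundary !interiorE closure_preim_mx//.
by rewrite -[~` preim_mx M B]/(preim_mx M (~` B)) closure_preim_mx.
Qed.

Lemma open_upper_orthant (a : R) : open (@upper_orthant R n a).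
Proof.
rewrite -minv_gtE.
by apply: (@open_comp _ _ (@minv R n) [set y | a < y]);
  [move=> z _; exact: continuous_minv|exact: open_gt].
Qed.

Lemma orthant_bounded_away B : B `<=` orthant -> bounded_away_boundary B ->
  exists2 e, 0 < e & B `<=` upper_orthant e.
Proof.
move=> Bo [e e0 Be]; exists (e / 2); first by rewrite divr_gt0.
move=> x Bx i; apply: (@lt_le_trans _ _ e).
  by rewrite ltr_pdivrMr// ltr_pMr// ltr1n.
(* Zeroing coordinate [i] reaches the boundary at sup-norm distance exactly [x i ord0], so this
   coordinate is at least [e]; halving [e] makes the bound strict. *)
pose y : 'cV[R]_n.+1 := \col_j (if j == i then 0 else x j ord0).
have /(Be _ _ Bx) : boundary orthant y.
  split; last first.
    by move=> /interior_subset /(_ i); rewrite mxE eqxx ltxx.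
  move=> C /nbhs_ballP[r /= r0 rC].
  (* A point of the orthant within [r] of [y], showing that [y] is in the closure. *)
  pose y' : 'cV[R]_n.+1 := \col_j (if j == i then r / 2 else x j ord0).
  exists y'; split.
    by move=> j; rewrite mxE; case: ifPn => _; [rewrite divr_gt0|exact: Bo].
  apply: rC; split => // j k; rewrite !mxE; case: ifPn => _; rewrite /ball/=.
    by rewrite sub0r normrN gtr0_norm ?divr_gt0// ltr_pdivrMr// ltr_pMr// ltr1n.
  by rewrite subrr normr0.
move=> /le_trans; apply.
rewrite -[`|x - y|]/(mx_norm (x - y)) mx_normrE.
apply: bigmax_le => [|[j k] _ /=]; first exact/ltW/Bo.
rewrite !mxE [k]ord1; case: ifPn => [/eqP ->|_].
  by rewrite subr0 gtr0_norm//; exact: Bo.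
by rewrite subrr normr0; exact/ltW/Bo.
Qed.

Lemma upper_orthant_bounded_away B (e : R) : 0 < e -> B `<=` upper_orthant e ->
  bounded_away_boundary B.
Proof.
move=> e0 Be; exists e => // x y /Be xe [_].
rewrite (interior_id _).1; last exact: open_upper_orthant.
move=> /existsNP[i /negP]; rewrite -leNgt => yi.
rewrite -[`|x - y|]/(mx_norm (x - y)) mx_normrE.
apply: (@le_trans _ _ `|(x - y) i ord0|).
  rewrite !mxE ger0_norm; have := xe i; lra.
exact: (@le_bigmax _ _ _ 0 (fun ij => `|(x - y) ij.1 ij.2|) (i, ord0)).
Qed.

(** Passing to the closure only weakens the strict bounds by [t] to large ones, which still imply
    strict bounds by [s]. *)
Lemma boundary_upper_orthant_sub B (s t : R) : s < t ->
  B `<=` upper_orthant t -> boundary B `<=` upper_orthant s.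
Proof.
move=> st Bt x [clx _] i; apply: (lt_le_trans st).
rewrite leNgt; apply/negP => xi.
have : nbhs x [set z : 'cV[R]_n.+1 | z i ord0 < t].
  apply: open_nbhs_nbhs; split => //.
  by apply: (@open_comp _ _ (fun z : 'cV[R]_n.+1 => z i ord0) [set y | y < t]);
    [move=> z _; exact: coord_continuous|exact: open_lt].
by move=> /clx [z [/Bt /(_ i) tz /=]]; rewrite ltNge ltW.
Qed.

Lemma boundary_upper_orthant (s t : R) : s < t ->
  boundary (@upper_orthant R n t) `<=` upper_orthant s `\` upper_orthant t.
Proof.
move=> st x bx; split; first exact: (boundary_upper_orthant_sub st) bx.
by case: bx => _; rewrite (interior_id _).1//; exact: open_upper_orthant.
Qed.

End Topology.

(** * Borel measurability of matrix operations and of [tau_mx] *)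

Section Measurability.
Context {R : realType}.

Lemma borel_open (S : ptopologicalType) (U : set (borel S)) :
  open (U : set S) -> measurable U.
Proof. exact: sub_sigma_algebra. Qed.

Lemma borel_closure (S : ptopologicalType) (U : set S) :
  measurable (closure U : set (borel S)).
Proof.
rewrite -[closure U]setCK; apply: measurableC; apply: borel_open.
by apply: closed_openC; exact: closed_closure.
Qed.

Lemma borel_boundary (S : ptopologicalType) (U : set S) :
  measurable (boundary U : set (borel S)).
Proof.
apply: measurableD; first exact: borel_closure.
by apply: borel_open; exact: open_interior.
Qed.

Lemma continuous_borel (S : ptopologicalType) (f : S -> R) :
  continuous f -> measurable_fun setT (f : borel S -> R).
Proof.
move=> /continuousP cf; apply: (measurability _ (RGenOpens.measurableE R)).
move=> _ [_ [a [b ->] <-]]; rewrite setTI; apply: borel_open.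
by apply: cf; exact: interval_open.
Qed.

Lemma measurable_coord m k (i : 'I_m) (j : 'I_k) :
  measurable_fun setT (fun M : borel 'M[R]_(m, k) => (M : 'M[R]_(m, k)) i j).
Proof.
apply: (@continuous_borel 'M[R]_(m, k) (fun M : 'M[R]_(m, k) => M i j)).
exact: coord_continuous.
Qed.

(* The balls with rational centre and radius form a countable basis. *)
Lemma measurable_borel_mx d (S : measurableType d) m k
    (f : S -> borel 'M[R]_(m, k)) :
  (forall i j, measurable_fun setT (fun x => (f x : 'M[R]_(m, k)) i j)) ->
  measurable_fun setT f.
Proof.
move=> mf; apply: (@measurability _ _ S (borel 'M[R]_(m, k)) setT f
  (@open 'M[R]_(m, k)) erefl) => _ [U oU <-]; rewrite setTI.
pose box (q : 'M[rat]_(m, k) * rat) : set 'M[R]_(m, k) :=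
  [set M | forall i j, `|ratr (q.1 i j) - M i j| < ratr q.2].
have -> : f @^-1` U = \bigcup_(q : 'M[rat]_(m, k) * rat)
    (if `[< box q `<=` U >] then f @^-1` box q else set0).
  apply/seteqP; split=> [x /= Ux|x [q _]]; last first.
    by case: ifPn => // /asboolP qU /qU.
  have /nbhs_ballP[r /= r0 rU] : nbhs (f x) U by exact: open_nbhs_nbhs.
  have [e /andP[e0 er]] : exists e : rat, 0 < (ratr e : R) < r / 2.
    have /rat_in_itvoo[e] : 0 < r / 2 by rewrite divr_gt0.
    by rewrite in_itv/= => ?; exists e.
  have qex i j : exists q : rat, `|ratr q - (f x : 'M[R]_(m, k)) i j| < ratr e.
    have /rat_in_itvoo[q] :
        (f x : 'M[R]_(m, k)) i j < (f x : 'M[R]_(m, k)) i j + ratr e.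
      by rewrite ltrDl.
    rewrite in_itv/= => /andP[? ?]; exists q; rewrite ltr_norml.
    by apply/andP; split; lra.
  pose q := (\matrix_(i, j) projT1 (cid (qex i j)), e).
  have xq : box q (f x) by move=> i j /=; rewrite mxE; case: cid.
  exists q => //; rewrite asboolT// => M Mq; apply: rU; split => // i j.
  rewrite /ball/=; have := Mq i j; have := xq i j.
  by rewrite /= !ltr_norml => /andP[? ?] /andP[? ?]; apply/andP; split; lra.
apply: countable_bigcupT_measurable; first exact: countableP.
move=> q; case: ifPn => // _.
rewrite (_ : f @^-1` box q = \bigcap_(i : 'I_m) \bigcap_(j : 'I_k)
    [set x | `|ratr (q.1 i j) - (f x : 'M[R]_(m, k)) i j| < ratr q.2]);
  last first.
  by apply/seteqP; split=> [x h i _ j _|x h i j]; [exact: h|exact: h].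
apply: fin_bigcap_measurable => [|i _]; first exact: finite_finset.
apply: fin_bigcap_measurable => [|j _]; first exact: finite_finset.
rewrite -[X in measurable X]setTI; apply: (mf i j measurableT
  (ball (ratr (q.1 i j) : R) (ratr q.2 : R))).
by rewrite ball_itv; exact: measurable_itv.
Qed.

(** The source carries the product of two Borel sigma-algebras, so continuity alone would not
    suffice; the entries are sums of products of measurable coordinates. *)
Lemma measurable_mulmx m k l : measurable_fun setT
  (fun p : borel 'M[R]_(m, k) * borel 'M[R]_(k, l) =>
    (p.1 : 'M[R]_(m, k)) *m (p.2 : 'M[R]_(k, l)) : borel 'M[R]_(m, l)).
Proof.
apply: measurable_borel_mx => i j.
under eq_fun do rewrite mxE.
apply: measurable_sum => u; apply: measurable_funM.
  by apply: (measurableT_comp (measurable_coord i u)); exact: measurable_fst.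
by apply: (measurableT_comp (measurable_coord u j)); exact: measurable_snd.
Qed.

Lemma measurable_upper_orthant n a :
  measurable (@upper_orthant R n a : set (borel 'cV[R]_n.+1)).
Proof. by apply: borel_open; exact: open_upper_orthant. Qed.

Lemma measurable_orthant n :
  measurable (@orthant R n : set (borel 'cV[R]_n.+1)).
Proof. exact: measurable_upper_orthant. Qed.

Lemma measurable_mulmxl m k l (M : 'M[R]_(m, k)) : measurable_fun setT
  (fun p : borel 'M[R]_(k, l) =>
    M *m (p : 'M[R]_(k, l)) : borel 'M[R]_(m, l)).
Proof.
exact: (measurable_fun_pair2 (M : borel _) (@measurable_mulmx m k l)).
Qed.

Lemma measurable_preim_mx n (M : 'M[R]_n.+1) (B : set (borel 'cV[R]_n.+1)) :
  measurable B -> measurable (preim_mx M B : set (borel 'cV[R]_n.+1)).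
Proof.
move=> mB; rewrite -[preim_mx _ _]setTI.
exact: (@measurable_mulmxl n.+1 n.+1 1 M measurableT B mB).
Qed.

Lemma scale_set_preim n t (B : set 'cV[R]_n.+1) : 0 < t ->
  scale_set t B = preim_mx (t^-1)%:M B.
Proof.
move=> t0; rewrite scale_setE//; apply/seteqP.
by split=> z; rewrite /preim_mx/= mul_scalar_mx.
Qed.

Lemma measurable_scale_set n t (B : set (borel 'cV[R]_n.+1)) : 0 < t ->
  measurable B -> measurable (scale_set t B : set (borel 'cV[R]_n.+1)).
Proof.
by move=> t0 mB; rewrite scale_set_preim//; exact: measurable_preim_mx.
Qed.

Lemma continuous_tau n : continuous (@tau R n).
Proof.
move=> z; apply: (@continuous_comp _ _ _ (@posv R n) (@minv R n)); last first.
  exact: continuous_minv.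
move: z; apply: continuous_mx => i j z.
under eq_fun do rewrite mxE.
apply: (@continuous_comp _ _ _ (fun z : 'cV[R]_n.+1 => z i ord0)
  (fun u => Num.max u 0)).
  exact: coord_continuous.
by apply: continuous_max; [exact: cvg_id|exact: cvg_cst].
Qed.

(** A supremum of uncountably many continuous functions is lower semicontinuous: its strict
    superlevel sets are unions of open sets. *)
Lemma measurable_tau_mx n :
  measurable_fun setT (fun M : borel 'M[R]_n.+1 => tau_mx (M : 'M[R]_n.+1)).
Proof.
apply: (measurability _ (ErealGenOInfty.measurableE R)).
move=> _ [_ [a ->] <-]; rewrite setTI; apply: borel_open.
rewrite (_ : _ @^-1` _ = \bigcup_(x in @tau_sphere R n)
    [set M : 'M[R]_n.+1 | a < tau (M *m x)]); last first.
  apply/seteqP; split=> [M /=|M [x sx /= aM] /=]; rewrite in_itv/= andbT.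
    by move=> /ereal_sup_gt[_ [x sx <-]]; rewrite lte_fin => ax; exists x.
  apply: (@lt_le_trans _ _ (tau (M *m x))%:E); first by rewrite lte_fin.
  by apply: ereal_sup_ubound; exists x.
apply: bigcup_open => x _.
apply: (@open_comp _ _ (fun M : 'M[R]_n.+1 => tau (M *m x)) [set y | a < y]);
  last exact: open_gt.
move=> M _; apply: (@continuous_comp _ _ _ (fun M : 'M[R]_n.+1 => M *m x)
  (@tau R n)); last first.
  exact: continuous_tau.
move: M; apply: continuous_mx => i j.
under eq_fun do rewrite mxE.
apply: continuous_sum => u M.
have h := @coord_continuous R n.+1 n.+1 i u M.
exact: (@cvgMr_tmp R 'M[R]_n.+1 (nbhs M) _ _ _ _ h).
Qed.

End Measurability.

(** * Homogeneous measures on the orthant *)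

Section HomogeneousMeasures.
Context {R : realType} {n : nat}.
Implicit Types (m : {measure set (borel 'cV[R]_n.+1) -> \bar R}).

Lemma homogeneous_upper_orthant m k (t : R) : homogeneous m k -> 0 < t ->
  m (upper_orthant t) = ((t `^ k)%:E * m (upper_orthant 1))%E.
Proof.
move=> hm t0; rewrite -[in LHS](mulr1 t) -scale_upper_orthant// hm//.
  exact: measurable_upper_orthant.
exact: upper_orthantS ler01.
Qed.

(** For every [r < 1] the boundary lies in the shell between levels [r * t] and [t], whose mass
    tends to 0 as [r] tends to 1. *)
Lemma homogeneous_boundary m (a : R) (t : R) : 0 < a ->
  homogeneous m (- a) -> (m (upper_orthant 1) < +oo)%E -> 0 < t ->
  m (boundary (upper_orthant t)) = 0%E.
Proof.
move=> a0 hm m1 t0.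
have [c c0 mc] : exists2 c : R, 0 <= c & m (upper_orthant 1) = c%:E.
  have : (0 <= m (upper_orthant 1))%E by [].
  by case: (m (upper_orthant 1)) m1 => // c _; rewrite lee_fin; exists c.
have mE s : 0 < s -> m (upper_orthant s) = (s `^ (- a) * c)%:E.
  by move=> s0; rewrite (homogeneous_upper_orthant hm)// mc.
apply/eqP; rewrite eq_le measure_ge0 andbT; apply/lee_addgt0Pr => e e0.
rewrite add0e.
have tc0 : 0 < t `^ (- a) * c + 1.
  by rewrite ltr_wpDl// mulr_ge0// powR_ge0.
(* The shell will have mass h t^(-a) c, which this choice keeps below [e]; the summand 1 guards
   against [c = 0]. *)
pose h := e / (t `^ (- a) * c + 1).
have h0 : 0 < h by rewrite divr_gt0.
(* The solution of r^(-a) = 1 + h. *)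
pose r := (1 + h) `^ (- a^-1).
have r0 : 0 < r by rewrite powR_gt0// addr_gt0.
have ra : r `^ (- a) = 1 + h.
  by rewrite -powRrM mulrNN mulVf ?gt_eqF// powRr1// addr_ge0// ltW.
have r1 : r < 1.
  rewrite ltNge; apply/negP => r1.
  have : r `^ (- a) <= 1.
    rewrite powRN invf_le1; last exact: powR_gt0.
    have := @ge0_ler_powR _ a (ltW a0) 1 r; rewrite powR1 !nnegrE; apply => //.
    exact: ltW.
  by rewrite ra; lra.
have trt : r * t < t by rewrite gtr_pMl.
apply: (@le_trans _ _ (m (upper_orthant (r * t) `\` upper_orthant t))).
  apply: le_measure; rewrite ?inE; last exact: boundary_upper_orthant.
    exact: borel_boundary.
  by apply: measurableD; exact: measurable_upper_orthant.
have -> : m (upper_orthant (r * t) `\` upper_orthant t) =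
    (m (upper_orthant (r * t)) - m (upper_orthant t))%E.
  rewrite measureD ?setIidr//; first exact/upper_orthantS/ltW.
  - exact: measurable_upper_orthant.
  - exact: measurable_upper_orthant.
  - by rewrite /= mE ?mulr_gt0// ltry.
rewrite !mE ?mulr_gt0// powRM ?(ltW r0) ?(ltW t0)// ra -EFinB lee_fin.
have : h * (t `^ (- a) * c + 1) = e by rewrite /h divfK// gt_eqF.
by lra.
Qed.

Lemma orthant_bigcup :
  @orthant R n = \bigcup_(k : nat) upper_orthant (k.+1%:R^-1).
Proof.
apply/seteqP; split=> [z /minv_gtP z0|z [k _]]; last first.
  by apply: upper_orthantS; rewrite invr_ge0.
have [k _ kz] := @nbhs_infty_gtr R (minv z)^-1.
exists k => //; apply/minv_gtP; rewrite invf_plt ?posrE//.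
have := kz k (leqnn k) => /lt_trans; apply; by rewrite ltr_nat.
Qed.

Lemma orthant_sigma_finite m : orthant_measure m ->
  (forall x : R, 0 < x -> (m (upper_orthant x) < +oo)%E) ->
  sigma_finite setT m.
Proof.
move=> mo mfin.
exists (fun k => ~` orthant `|` upper_orthant (k.+1%:R^-1)).
  apply/seteqP; split=> // z _; have [|nz] := pselect (orthant z).
    by rewrite {1}orthant_bigcup => -[k _ zk]; exists k => //; right.
  by exists 0%N => //; left.
move=> k; split.
  apply: measurableU; last exact: measurable_upper_orthant.
  by apply: measurableC; exact: measurable_orthant.
apply: (@le_lt_trans _ _ (m (~` orthant) + m (upper_orthant (k.+1%:R^-1)))%E).
  apply: measureU2; last exact: measurable_upper_orthant.
  by apply: measurableC; exact: measurable_orthant.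
by rewrite mo add0e mfin// invr_gt0.
Qed.

(** Otherwise homogeneity makes every [upper_orthant] of positive level null, hence also their
    countable union, the orthant. *)
Lemma measure_upper_orthant_gt0 m k : homogeneous m k -> m orthant != 0%E ->
  (0 < m (upper_orthant 1))%E.
Proof.
move=> hm m0; rewrite lt0e measure_ge0 andbT; apply: contra_neq m0 => m1.
apply/eqP; rewrite eq_le measure_ge0 andbT orthant_bigcup.
apply: (@le_trans _ _
    (\sum_(0 <= k <oo) m (upper_orthant (k.+1%:R^-1)))%E).
  apply: measure_sigma_subadditive => //.
  - by move=> i; exact: measurable_upper_orthant.
  - by apply: bigcupT_measurable => i; exact: measurable_upper_orthant.
rewrite eseries0// => i _ _.
by rewrite (homogeneous_upper_orthant hm) ?invr_gt0// m1 mule0.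
Qed.

End HomogeneousMeasures.

(** Turns the proposition [sigma_finite] into the bundled structure that product measures and
    section measurability require. *)
Lemma sigma_finite_measure_ex d (T : measurableType d) (R : realType)
    (m : {measure set T -> \bar R}) : sigma_finite setT m ->
  exists m' : {sigma_finite_measure set T -> \bar R}, forall B, m' B = m B.
Proof.
move=> sm.
pose H1 := isSFinite.Build _ _ _ (Measure.sort m)
  (sfinite_measure_sigma_finite sm).
pose H2 := isSigmaFinite.Build _ _ _ (Measure.sort m) sm.
by exists (HB.pack_for (SigmaFiniteMeasure.type T R) (Measure.sort m) H1 H2).
Qed.

(** * A one-sided Potter bound for monotone functions *)

Section Potter.
Context {R : realType}.
Variables (p : R -> R) (a b : R).
Hypotheses (a0 : 0 < a) (ab : a < b) (p0 : forall x, 0 < p x)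
  (p1 : forall x, p x <= 1) (p_ni : {homo p : x y / x <= y >-> y <= x})
  (p2 : p (x * 2) / p x @[x --> +oo] --> 2 `^ (- a)).

Let potter_doubling : exists2 x0, 0 < x0 &
  forall y, x0 <= y -> p y <= 2 `^ b * p (y * 2).
Proof.
have ba : 2 `^ (- b) < 2 `^ (- a) :> R.
  by rewrite /powR pnatr_eq0/= ltr_expR ltr_pM2r ?ln_gt0 ?ltr1n// ltrN2.
have [M [_ hM]] := cvgr_gt _ p2 _ ba.
(* The limit gives the estimate only for [y > M], hence the [+ 1]. *)
exists (Num.max (M + 1) 1); first by rewrite lt_max ltr01 orbT.
move=> y; rewrite ge_max => /andP[My y1].
have /hM : M < y by lra.
rewrite ltr_pdivlMr// => /ltW h.
rewrite -ler_pdivrMl ?powR_gt0//.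
by rewrite -powRN.
Qed.

(** Doubling is iterated up to the first power of 2 above [s]. Monotonicity of [p] handles the
    overshoot, which is by a factor of at most 2 and costs the extra 2^b. *)
Let potter_ge1 : exists2 x0, 0 < x0 &
  forall y s, x0 <= y -> 1 <= s -> p y <= 2 `^ b * s `^ b * p (y * s).
Proof.
have [x0 x00 hx] := potter_doubling; exists x0 => // y s xy s1.
have hk k : p y <= (2 ^+ k) `^ b * p (y * 2 ^+ k).
  elim: k => [|k IH]; first by rewrite expr0 powR1 mul1r mulr1.
  have /hx h : x0 <= y * 2 ^+ k.
    apply: (le_trans xy); rewrite ler_peMr ?(le_trans (ltW x00))//.
    by rewrite exprn_ege1// ler1n.
  apply: (le_trans IH); rewrite exprSr powRM ?exprn_ge0// [y * (_ * _)]mulrA.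
  by rewrite -mulrA ler_pM2l// powR_gt0 ?exprn_gt0.
have [k sk] : exists k, s < 2 ^+ k.
  exists (Num.bound s); apply: (lt_trans (archi_boundP (le_trans ler01 s1))).
  by rewrite -natrX ltr_nat ltn_expl.
case: (ex_minnP (ex_intro (fun k => s < 2 ^+ k) k sk)) => -[|j] sj jmin.
  by move: sj; rewrite expr0 ltNge s1.
have js : 2 ^+ j <= s.
  by rewrite leNgt; apply/negP => /jmin; rewrite ltnn.
apply: (le_trans (hk j.+1)); apply: ler_pM; rewrite ?powR_ge0 ?(ltW (p0 _))//.
  rewrite exprS powRM ?exprn_ge0// ler_pM2l ?powR_gt0//.
  apply: ge0_ler_powR; rewrite ?nnegrE ?exprn_ge0//.
    exact/ltW/(lt_trans a0).
  exact: le_trans s1.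
by apply: p_ni; rewrite ler_pM2l ?(lt_le_trans x00)// ltW.
Qed.

Lemma potter_bound : exists2 x0, 0 < x0 & exists2 K, 0 <= K &
  forall x s, x0 <= x -> 0 < s -> p (x / s) <= K * (1 + s `^ b) * p x.
Proof.
have [x0 x00 hx] := potter_ge1.
(* One summand per case: [s <= 1], where monotonicity suffices; [x0 <= x / s], where [potter_ge1]
   applies at [x / s]; and [x / s < x0]. *)
exists x0 => //; exists (1 + 2 `^ b + 2 `^ b / p x0).
  by rewrite !addr_ge0// ?divr_ge0// ?powR_ge0// ltW.
move=> x s xx s0; have x_gt0 : 0 < x by exact: lt_le_trans xx.
set C := 2 `^ b; set D := C / p x0.
have C0 : 0 < C by exact: powR_gt0.
have D0 : 0 < D by rewrite divr_gt0.
have sb : 0 < s `^ b by exact: powR_gt0.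
have px := p0 x.
have le1 u : u <= 1 + C + D ->
    u * (1 + s `^ b) * p x <= (1 + C + D) * (1 + s `^ b) * p x.
  by move=> ?; rewrite ler_pM2r// ler_pM2r// addr_gt0.
have [s1|s1] := leP s 1.
  apply: le_trans (le1 1 _); last by lra.
  apply: (@le_trans _ _ (p x)); last by rewrite mul1r ler_peMl// ?ltW//; lra.
  by apply: p_ni; rewrite ler_pdivlMr// ler_piMr// ltW.
have [xs|xs] := leP x0 (x / s).
  apply: le_trans (le1 C _); last by lra.
  apply: (le_trans (hx _ _ xs (ltW s1))); rewrite divfK ?gt_eqF// ler_pM2r//.
  by rewrite ler_pM2l//; lra.
(* Here [x / s] is too small for [potter_ge1], so [p (x / s)] is bounded by 1, and [p x] from below
   by comparison with [p x0], using [x / x0 < s]. *)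
apply: le_trans (le1 D _); last by lra.
apply: (le_trans (p1 _)).
have : p x0 <= C * s `^ b * p x.
  have x1 : 1 <= x / x0 by rewrite ler_pdivlMr// mul1r.
  apply: (le_trans (hx _ _ (lexx x0) x1)).
  rewrite [x0 * _]mulrC divfK ?gt_eqF// ler_pM2r// ler_pM2l//.
  rewrite ge0_ler_powR// ?nnegrE ?(ltW (lt_trans a0 ab)) ?divr_ge0 ?(ltW s0)
    ?(ltW x00) ?(ltW x_gt0)//.
  rewrite ltW// ltr_pdivrMr// mulrC; by move: xs; rewrite ltr_pdivrMr.
move=> h; apply: (@le_trans _ _ (D * s `^ b * p x)).
  rewrite /D mulrAC -mulrA mulrC mulrA ler_pdivlMr// mul1r.
  by apply: (le_trans h); rewrite le_eqVlt; apply/orP; left; apply/eqP; ring.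
by rewrite ler_pM2r// ler_pM2l//; lra.
Qed.

End Potter.

Local Open Scope ereal_scope.

(** * Lower integrals and integration under independence *)

Section Probability.
Context {d : measure_display} {T : measurableType d} {R : realType}.

(* No measurability is assumed: [\int[m] f] is then the lower integral. *)
Lemma le_lower_integral (m : {measure set T -> \bar R}) (f g : T -> \bar R) :
  (forall x, 0 <= f x) -> (forall x, f x <= g x) ->
  \int[m]_x f x <= \int[m]_x g x.
Proof.
move=> f0 fg; have g0 x : 0 <= g x by exact: le_trans (fg x).
rewrite !ge0_integralTE//; apply: le_ereal_sup => _ [h hf <-].
by exists h => // x; exact: le_trans (fg x).
Qed.

Lemma dive_EFin (a b : R) : b != 0%R -> a%:E / b%:E = (a / b)%:E.
Proof. by move=> b0; rewrite inver (negbTE b0). Qed.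

(** Independence identifies the joint law with the product law on rectangles, hence everywhere by
    uniqueness of product measures; the right-hand side integrates the sections of [E]. *)
Lemma integral_independent (P : probability T R) (d1 d2 : measure_display)
    (T1 : measurableType d1) (T2 : measurableType d2)
    (X : {RV P >-> T1}) (Y : {RV P >-> T2}) (E : set (T1 * T2)) :
  independent_rv X Y -> measurable E ->
  P [set w | E (X w, Y w)] = \int[P]_w P [set w' | E (X w, Y w')].
Proof.
move=> XY mE.
have mXY : measurable_fun setT (fun w => (X w, Y w)).
  exact: measurable_fun_pair.
have := @product_measure_unique _ _ T1 T2 R (distribution P X)
  (distribution P Y) (pushforward P (fun w => (X w, Y w))).
have XYE (U : set T1) (V : set T2) : measurable U -> measurable V ->
  pushforward P (fun w => (X w, Y w)) (U `*` V) =
  distribution P X U * distribution P Y V by exact: XY.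
move=> /(_ mXY XYE E mE) h.
transitivity ((distribution P X \x distribution P Y) E).
  by rewrite h.
have mx := @measurable_fun_xsection _ _ T1 T2 R (distribution P Y) E mE.
rewrite /product_measure1 (ge0_integral_distribution _ mx)//.
apply: eq_integral => w _ /=; rewrite /distribution/= /pushforward/=.
by congr (P _); apply/seteqP; split=> w' /=; rewrite /xsection/= inE.
Qed.

End Probability.

(** * Tail of the minimum and normalisation of the limit measure *)

Section RegularVariationFacts.
Context {R : realType} {d : measure_display} {T : measurableType d}.
Context (P : probability T R) {n : nat}.
Variables (Z : T -> borel 'cV[R]_n.+1)
  (nu : {measure set (borel 'cV[R]_n.+1) -> \bar R}) (alpha : R).
Hypotheses (alpha_gt0 : (0 < alpha)%R)
  (Z_rv : regularly_varying_index P Z nu (- alpha)%R).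

Let homog : homogeneous nu (- alpha)%R. Proof. by case: Z_rv. Qed.
Let nu_fin x : (0 < x)%R -> nu (upper_orthant x) < +oo.
Proof. by case: Z_rv => -[_ _ _ h _] _; exact: h. Qed.
Let mZ : measurable_fun setT Z. Proof. by case: Z_rv => -[]. Qed.

Let tail x : \bar R := P (Z @^-1` upper_orthant x).

Let measurable_tail x : measurable (Z @^-1` upper_orthant x).
Proof.
rewrite -[X in measurable X]setTI; apply: mZ => //.
exact: measurable_upper_orthant.
Qed.

Let tail_fin x : tail x \is a fin_num.
Proof. exact: fin_num_measure. Qed.

Lemma minv_tailE (Y : T -> 'cV[R]_n.+1) (x : R) :
  [set w | (x < minv (Y w))%R] = Y @^-1` upper_orthant x.
Proof. by apply/seteqP; split=> w /= /minv_gtP. Qed.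

Let tail_ni x y : (x <= y)%R -> tail y <= tail x.
Proof.
move=> xy; apply: le_measure; rewrite ?inE//.
by move=> w; exact: upper_orthantS.
Qed.

(** The defining limit for [upper_orthant t], a continuity set by [homogeneous_boundary]. *)
Let tail_ratio t : (0 < t)%R ->
  tail (x * t) / tail x @[x --> +oo%R] --> nu (upper_orthant t).
Proof.
move=> t0; have [[_ _ _ _ /(_ (upper_orthant t))]] := Z_rv.
move=> h _.
have {}h := h (measurable_upper_orthant _) (upper_orthantS (ltW t0))
  (upper_orthant_bounded_away t0 (@subset_refl _ _))
  (homogeneous_boundary alpha_gt0 homog (nu_fin ltr01) t0).
apply: cvg_trans h; apply: near_eq_cvg; near=> x.
rewrite minv_tailE /tail; congr (P _ / _).
by rewrite scale_upper_orthant//; near: x; exact: nbhs_pinfty_gt.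
Unshelve. all: by end_near. Qed.

(** A tail vanishing at [x] vanishes beyond it, so the quotients would tend to 0 instead of the
    positive [nu (upper_orthant 1)]. *)
Lemma rv_tail_gt0 x : 0 < P (Z @^-1` upper_orthant x).
Proof.
have nu0 : 0 < nu (upper_orthant 1).
  by apply: measure_upper_orthant_gt0 homog _; case: Z_rv => -[].
have h := tail_ratio ltr01.
rewrite lt0e measure_ge0 andbT; apply/eqP => tx.
have : (fun x => tail (x * 1) / tail x) @ +oo%R --> (0 : \bar R).
  apply: cvg_near_cst; apply: filterS (nbhs_pinfty_ge (num_real x)) => y xy.
  suff -> : tail (y * 1) = 0 by rewrite mul0e.
  by apply/eqP; rewrite eq_le measure_ge0 andbT -[leRHS]tx mulr1 tail_ni.
by move=> /(cvg_unique (@ereal_hausdorff R) h) nu1; move: nu0; rewrite nu1 ltxx.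
Qed.

(** For this set numerator and denominator of the quotient coincide. *)
Lemma rv_upper_orthant1 : nu (upper_orthant 1) = 1.
Proof.
have h := tail_ratio ltr01.
have : (fun x => tail (x * 1) / tail x) @ +oo%R --> (1 : \bar R).
  apply: cvg_near_cst; apply: nearW => y.
  rewrite mulr1 -(fineK (tail_fin y)) dive_EFin ?divff//.
    by rewrite fine_eq0// gt_eqF// rv_tail_gt0.
  by rewrite fine_eq0// gt_eqF// rv_tail_gt0.
by move=> /(cvg_unique (@ereal_hausdorff R) h).
Qed.

Lemma rv_upper_orthant t : (0 < t)%R ->
  nu (upper_orthant t) = (t `^ (- alpha))%:E.
Proof.
move=> t0.
by rewrite (homogeneous_upper_orthant homog)// rv_upper_orthant1 mule1.
Qed.

Lemma rv_potter (b : R) : (alpha < b)%R -> exists2 x0 : R, (0 < x0)%R &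
  exists2 K : R, (0 <= K)%R & forall x s : R, (x0 <= x)%R -> (0 < s)%R ->
    P (Z @^-1` upper_orthant (x / s)) <=
    (K * (1 + s `^ b))%:E * P (Z @^-1` upper_orthant x).
Proof.
move=> ab; pose p x := fine (tail x).
have tailE x : tail x = (p x)%:E by rewrite fineK.
have p_gt0 x : (0 < p x)%R by rewrite -lte_fin -tailE rv_tail_gt0.
have [x0 x00 [K K0 h]] : exists2 x0 : R, (0 < x0)%R &
    exists2 K : R, (0 <= K)%R & forall x s : R, (x0 <= x)%R -> (0 < s)%R ->
      (p (x / s) <= K * (1 + s `^ b) * p x)%R.
  apply: (@potter_bound R p alpha b) => //.
  - by move=> x; rewrite -lee_fin -tailE probability_le1.
  - by move=> x y xy; rewrite -lee_fin -!tailE tail_ni.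
  - have := tail_ratio (ltr0Sn _ 1); rewrite rv_upper_orthant// => /fine_cvg.
    apply: cvg_trans; apply: near_eq_cvg; apply: nearW => x /=.
    by rewrite !tailE dive_EFin// gt_eqF.
exists x0 => //; exists K => // x s xx s0.
by rewrite -!/(tail _) !tailE -EFinM lee_fin h.
Qed.

End RegularVariationFacts.

(** * Measures and scaling of matrix preimages *)

Section Preimages.
Context {R : realType} {n : nat}.
Implicit Types (B : set (borel 'cV[R]_n.+1)) (M : 'M[R]_n.+1).

Lemma measurable_mulmx_preimage B : measurable B -> measurable
  [set p : borel 'M[R]_n.+1 * borel 'cV[R]_n.+1 |
    B ((p.1 : 'M[R]_n.+1) *m (p.2 : 'cV[R]_n.+1))].
Proof.
move=> mB; rewrite -[X in measurable X]setTI.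
exact: (@measurable_mulmx R n.+1 n.+1 1 measurableT B mB).
Qed.

Lemma measurable_measure_preim
    (m : {measure set (borel 'cV[R]_n.+1) -> \bar R}) B :
  sigma_finite setT m -> measurable B ->
  measurable_fun setT (fun M : borel 'M[R]_n.+1 => m (preim_mx M B)).
Proof.
move=> sm mB; have [m' mE] := sigma_finite_measure_ex sm.
have := measurable_fun_xsection m' (measurable_mulmx_preimage mB).
apply: eq_measurable_fun => M _ /=; rewrite -mE; congr (m' _).
by apply/seteqP; split=> z /=; rewrite /xsection/= inE.
Qed.

Lemma scale_set_preim_mx M B (x : R) : (0 < x)%R ->
  scale_set x (preim_mx M B) = preim_mx M (scale_set x B).
Proof.
move=> x0; rewrite !scale_setE//; apply/seteqP.
by split=> z; rewrite /preim_mx/= -scalemxAr.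
Qed.

Lemma preim_mx_sub_upper_orthant M B (t e : R) : tau_mx M = t%:E -> (0 < t)%R ->
  (0 <= e)%R -> B `<=` upper_orthant e ->
  preim_mx M B `<=` upper_orthant (e / t).
Proof. by move=> Mt t0 e0 Be x /Be; exact: preim_upper_orthant. Qed.

Lemma powR_le1D (u a b : R) : (0 < u)%R -> (0 < a)%R -> (a <= b)%R ->
  (u `^ a <= 1 + u `^ b)%R.
Proof.
move=> u0 a0 ab; have [u1|u1] := leP u 1%R.
  apply: (@le_trans _ _ 1%R); last by rewrite lerDl powR_ge0.
  have := @ge0_ler_powR _ a (ltW a0) u 1%R; rewrite powR1 !nnegrE; apply => //.
  exact: ltW.
apply: (@le_trans _ _ (u `^ b)%R); last by rewrite lerDr.
by apply: ler_powR => //; exact: ltW.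
Qed.

End Preimages.

(** * The limit for AZ by dominated convergence *)

Section Breiman.
Context {R : realType} {disp : measure_display} {T : measurableType disp}.
Context (P : probability T R) {n : nat}.
Variables (Z : {RV P >-> borel 'cV[R]_n.+1}) (A : {RV P >-> borel 'M[R]_n.+1})
  (nu : {measure set (borel 'cV[R]_n.+1) -> \bar R}) (alpha delta : R).
Hypotheses (alpha_gt0 : (0 < alpha)%R)
  (Z_rv : regularly_varying_index P Z nu (- alpha)%R)
  (A_Z_indep : independent_rv A Z)
  (tauA_gt0 : {ae P, forall w, 0 < tau_mx (A w)})
  (delta_gt0 : (0 < delta)%R)
  (tauA_moment : \int[P]_w (tau_mx (A w) `^ (alpha + delta)) < +oo).

Let measurable_tauA : measurable_fun setT (fun w => tau_mx (A w)).
Proof. exact: (measurableT_comp (@measurable_tau_mx R n)). Qed.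

Let measurable_tauA_pow :
  measurable_fun setT (fun w => tau_mx (A w) `^ (alpha + delta)).
Proof. exact: (measurableT_comp (measurable_poweR _)). Qed.

Let b_gt0 : (0 < alpha + delta)%R. Proof. exact: addr_gt0. Qed.

Lemma tau_mx_ae : {ae P, forall w, 0 < tau_mx (A w) < +oo}.
Proof.
have /(integrable_ae measurableT) :
    P.-integrable setT (fun w => tau_mx (A w) `^ (alpha + delta)).
  apply/integrableP; split=> //.
  by under eq_integral do rewrite gee0_abs ?poweR_ge0//.
move: tauA_gt0; apply: filterS2 => w -> /= /(_ I).
by rewrite ltey; apply: contraTneq => ->; rewrite poweRyr// gt_eqF.
Qed.

Lemma measurable_tau_good : measurable [set w | 0 < tau_mx (A w) < +oo].
Proof.
rewrite (_ : mkset _ = (fun w => tau_mx (A w)) @^-1`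
    [set` Interval (BRight 0) (BLeft +oo)]).
  rewrite -[X in measurable X]setTI; apply: measurable_tauA => //.
  exact: emeasurable_itv.
by apply/seteqP; split=> w /=; rewrite in_itv.
Qed.

Let nu_sigma_finite : sigma_finite setT nu.
Proof. by case: Z_rv => -[_ ? _ ? _] _; exact: orthant_sigma_finite. Qed.

Lemma measurable_nu_preim (B : set (borel 'cV[R]_n.+1)) : measurable B ->
  measurable_fun setT (fun w => nu (preim_mx (A w) B)).
Proof.
move=> mB.
exact: (measurableT_comp (measurable_measure_preim nu_sigma_finite mB)).
Qed.

(** The integrand of the hypothesis need not be measurable. On the good event it equals the
    measurable [g], so the cut-off of [g] lies below it everywhere and has integral 0 by
    monotonicity of the lower integral. *)
Lemma boundary_preim_ae (B : set (borel 'cV[R]_n.+1)) :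
  \int[P]_w nu (boundary (preim_mx (A w) B)) = 0 ->
  {ae P, forall w, nu (boundary (preim_mx (A w) B)) = 0}.
Proof.
move=> B0; pose D := [set w | 0 < tau_mx (A w) < +oo].
pose g w := nu (preim_mx (A w) (boundary (B : set 'cV[R]_n.+1))).
have mg : measurable_fun setT (g \_ D).
  apply/(measurable_restrictT g measurable_tau_good).
  apply: measurable_funTS; apply: measurable_nu_preim; exact: borel_boundary.
have g0 w : 0 <= (g \_ D) w by apply: erestrict_ge0.
have gint : \int[P]_w `|(g \_ D) w| = 0.
  apply/eqP; rewrite eq_le; apply/andP; split; last first.
    by apply: integral_ge0 => w _; exact: abse_ge0.
  rewrite -B0; apply: le_lower_integral => w; first exact: abse_ge0.
  rewrite gee0_abs// patchE.
  case: ifPn => [/set_mem Dw|_]; last exact: measure_ge0.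
  by rewrite /g boundary_preim_mx// tau_mx_unit.
have gae := (ae_eq_integral_abs P measurableT mg).1 gint.
move: gae; have := tau_mx_ae; apply: filterS2 => w Dw /(_ I).
by rewrite patchE mem_set// /g boundary_preim_mx// tau_mx_unit.
Qed.

(** The Potter majorant, with [c] standing for [1 / e]. The extended-real power makes sense also
    where [tau_mx] is infinite and matches the moment hypothesis. *)
Let dominating (K c : R) w : \bar R :=
  K%:E * (1 + (c `^ (alpha + delta))%:E * (tau_mx (A w) `^ (alpha + delta))).

Let dominating_ge0 K c w : (0 <= K)%R -> 0 <= dominating K c w.
Proof.
move=> K0.
by rewrite mule_ge0// adde_ge0// mule_ge0 ?poweR_ge0// lee_fin powR_ge0.
Qed.

Let dominatingE K c w (t : R) :
  tau_mx (A w) = t%:E -> (0 <= t)%R -> (0 <= c)%R ->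
  dominating K c w = (K * (1 + (t * c) `^ (alpha + delta)))%:E.
Proof.
move=> wt t0 c0.
by rewrite /dominating wt poweR_EFin -EFinM -powRM// [(c * t)%R]mulrC.
Qed.

Let measurable_dominating K c : measurable_fun setT (dominating K c).
Proof.
apply: measurable_funeM; apply: emeasurable_funD => //.
exact: measurable_funeM.
Qed.

Let integrable_dominating K c : (0 <= K)%R ->
  P.-integrable setT (dominating K c).
Proof.
move=> K0; apply/integrableP; split; first exact: measurable_dominating.
under eq_integral do rewrite gee0_abs ?dominating_ge0//.
rewrite ge0_integralZl_EFin//; last 2 first.
- by move=> w _; rewrite adde_ge0// mule_ge0 ?poweR_ge0// lee_fin powR_ge0.
- by apply: emeasurable_funD => //; exact: measurable_funeM.
rewrite lte_mul_pinfty// ge0_integralD//; last 2 first.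
- by move=> w _; rewrite mule_ge0 ?poweR_ge0// lee_fin powR_ge0.
- exact: measurable_funeM.
apply: lte_add_pinfty.
  rewrite integral_cst// mul1e.
  exact: (le_lt_trans (probability_le1 P measurableT) (ltry 1)).
rewrite ge0_integralZl_EFin ?powR_ge0//; last by move=> w _; exact: poweR_ge0.
by rewrite lte_mul_pinfty// lee_fin powR_ge0.
Qed.

Lemma mean_preim_lty (B : set (borel 'cV[R]_n.+1)) (e : R) : measurable B ->
  (0 < e)%R -> B `<=` upper_orthant e -> mean_preim P A nu B < +oo.
Proof.
move=> mB e0 Be.
have /integrableP[_] := @integrable_dominating 1%R e^-1%R ler01.
apply: le_lt_trans; apply: ae_ge0_le_integral => //.
- exact: measurable_nu_preim.
- by apply: measurableT_comp => //; exact: measurable_dominating.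
have := tau_mx_ae; apply: filterS => w /andP[w0 woo] _.
have [t wt] : exists t, tau_mx (A w) = t%:E.
  by case: (tau_mx (A w)) w0 woo => // t; exists t.
move: w0; rewrite wt lte_fin => t0.
rewrite gee0_abs ?dominating_ge0//.
rewrite (dominatingE _ wt (ltW t0)) ?invr_ge0 ?(ltW e0)//.
(* This measure equals (t / e)^alpha, at most 1 + (t / e)^(alpha + delta), which is the majorant
   with [K = 1]. *)
apply: (@le_trans _ _ (nu (upper_orthant (e / t)))).
  apply: le_measure; rewrite ?inE.
  - exact: measurable_preim_mx.
  - exact: measurable_upper_orthant.
  - by apply: preim_mx_sub_upper_orthant; rewrite // ltW.
rewrite (rv_upper_orthant alpha_gt0 Z_rv) ?divr_gt0// lee_fin mul1r.
rewrite powRN -powR_inv1 ?powR_ge0// -powRrM [(_ * -1)%R]mulrC powRrM.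
rewrite powR_inv1 ?divr_ge0 ?(ltW e0) ?(ltW t0)// invf_div.
by apply: powR_le1D; rewrite ?divr_gt0// lerDl ltW.
Qed.

(** The boundary condition is stated almost surely because the two claims of the theorem reach it
    from different integrals. *)
Lemma breiman_limit (B : set (borel 'cV[R]_n.+1)) (e : R) : measurable B ->
  (0 < e)%R -> B `<=` upper_orthant e ->
  {ae P, forall w, nu (boundary (preim_mx (A w) B)) = 0} ->
  P [set w | scale_set x B (A w *m Z w)%R] / P [set w | (x < minv (Z w))%R]
    @[x --> +oo%R] --> mean_preim P A nu B.
Proof.
(* Dominated convergence is about sequences, so the limit is tested along an arbitrary [u], shifted
   below to stay in the range of the Potter bound. *)
move=> mB e0 Be B0; apply/cvge_pinftyP => u uoo.
have ab : (alpha < alpha + delta)%R by rewrite ltrDl.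
have [x0 x00 [K K0 potter]] := rv_potter alpha_gt0 Z_rv ab.
have [N _ uN] : \forall k \near \oo, (x0 <= u k)%R.
  by move/cvgryPge : uoo; apply.
rewrite -(cvg_shiftn N).
pose v k := u (k + N)%N.
have vx k : (x0 <= v k)%R by apply: uN => /=; rewrite leq_addl.
have v0 k : (0 < v k)%R by exact: lt_le_trans (vx k).
have voo : v k @[k --> \oo] --> +oo%R by rewrite /v (cvg_shiftn N u).
pose tail x := P (Z @^-1` upper_orthant x).
have tail_gt0 x : 0 < tail x by exact: rv_tail_gt0 alpha_gt0 Z_rv _.
pose f k w := P [set w' | scale_set (v k) B (A w *m Z w')%R] / tail (v k).
have mpre C : measurable C -> measurable (Z @^-1` C).
  by move=> mC; rewrite -[X in measurable X]setTI; exact: measurable_funP.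
have mtail x : measurable (Z @^-1` upper_orthant x).
  by apply: mpre; exact: measurable_upper_orthant.
have tailE x : exists2 r : R, (0 < r)%R & tail x = r%:E.
  have : tail x \is a fin_num by exact: fin_num_measure.
  have := tail_gt0 x; case: (tail x) => // r; rewrite lte_fin; exists r => //.
have mP k : measurable_fun setT
    (fun w => P [set w' | scale_set (v k) B (A w *m Z w')%R]).
  have sZ := sigma_finiteT (distribution P Z).
  have h := measurable_measure_preim sZ (measurable_scale_set (v0 k) mB).
  exact: (measurableT_comp h).
have mf k : measurable_fun setT (f k).
  rewrite /f; have [r r0 ->] := tailE (v k).
  under eq_fun do rewrite inver gt_eqF// muleC.
  exact: measurable_funeM.
(* By independence the quotient is the mean of the quotients [f k w] with the matrix frozen at
   [A w]. *)
rewrite (_ : (fun k => _) = (fun k => \int[P]_w f k w)); last first.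
  apply/funext => k; rewrite -/(v k) minv_tailE -/(tail _) /f.
  rewrite ge0_integralZr//; last by rewrite inve_ge0 measure_ge0.
  congr (_ / _).
  exact: (@integral_independent _ _ _ P _ _ _ _ A Z
    [set p | scale_set (v k) B ((p.1 : 'M[R]_n.+1) *m (p.2 : 'cV[R]_n.+1))%R]
    A_Z_indep (measurable_mulmx_preimage (measurable_scale_set (v0 k) mB))).
have [] := @dominated_convergence _ T R P setT measurableT f
  (fun w => nu (preim_mx (A w) B)) (dominating K e^-1%R) mf
  (measurable_nu_preim mB) _ (integrable_dominating _ K0) _; last by [].
- have := tau_mx_ae; move: B0; apply: filterS2 => w Bw /andP[w0 woo] _.
  have [t wt] : exists t, tau_mx (A w) = t%:E.
    by case: (tau_mx (A w)) w0 woo => // t; exists t.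
  move: w0; rewrite wt lte_fin => t0.
  have sub := preim_mx_sub_upper_orthant wt t0 (ltW e0) Be.
  have et0 : (0 < e / t)%R by rewrite divr_gt0.
  have [[_ _ _ _ rv] _] := Z_rv.
  have /cvge_pinftyP/(_ _ voo) := rv (preim_mx (A w) B)
    (measurable_preim_mx (A w) mB) (subset_trans sub (upper_orthantS (ltW et0)))
    (upper_orthant_bounded_away et0 sub) Bw.
  apply: cvg_trans; apply: near_eq_cvg; apply: nearW => k.
  by rewrite /f minv_tailE -/(tail _) scale_set_preim_mx.
- have := tau_mx_ae; apply: filterS => w /andP[w0 woo] k _.
  have [t wt] : exists t, tau_mx (A w) = t%:E.
    by case: (tau_mx (A w)) w0 woo => // t; exists t.
  move: w0; rewrite wt lte_fin => t0.
  rewrite gee0_abs; last by rewrite mule_ge0// inve_ge0 measure_ge0.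
  rewrite (dominatingE _ wt (ltW t0)) ?invr_ge0 ?(ltW e0)// /f.
  have te0 : (0 < t / e)%R by rewrite divr_gt0.
  have := potter (v k) (t / e)%R (vx k) te0; rewrite -/(tail (v k)).
  have [r r0 ->] := tailE (v k) => h.
  rewrite inver gt_eqF// lee_pdivrMr//; apply: le_trans h.
  apply: le_measure; rewrite ?inE.
  + have mvB := measurable_scale_set (v0 k) mB.
    exact: mpre (measurable_preim_mx (A w) mvB).
  + exact: mtail.
  + move=> w' /=.
    rewrite -[scale_set _ _ _]/(preim_mx (A w) (scale_set (v k) B) (Z w')).
    have -> : (v k / (t / e) = v k * e / t)%R by rewrite invf_div mulrA.
    apply: (preim_mx_sub_upper_orthant wt t0); first by rewrite mulr_ge0// ltW.
    by rewrite -scale_upper_orthant//; exact: image_subset.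
Qed.

Lemma mean_preim_scale (B : set (borel 'cV[R]_n.+1)) (t : R) : measurable B ->
  B `<=` orthant -> (0 < t)%R ->
  mean_preim P A nu (scale_set t B) =
  (t `^ (- alpha))%:E * mean_preim P A nu B.
Proof.
move=> mB Bo t0; rewrite -ge0_integralZl_EFin ?powR_ge0//; last first.
  exact: measurable_nu_preim.
apply: ge0_ae_eq_integral => //.
- by apply: measurable_nu_preim; exact: measurable_scale_set.
- by apply: measurable_funeM; exact: measurable_nu_preim.
- by move=> w _; rewrite mule_ge0// lee_fin powR_ge0.
(* Homogeneity is available only for subsets of the orthant, and [preim_mx (A w) B] is one only on
   the good event. *)
have := tau_mx_ae; apply: filterS => w w0 _.
have [_ homog] := Z_rv; rewrite -scale_set_preim_mx// homog//.
  exact: measurable_preim_mx.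
by move=> z /Bo /(preim_orthant w0).
Qed.

Lemma mean_preim_boundary_ae (B : set (borel 'cV[R]_n.+1)) :
  mean_preim P A nu (boundary (B : set 'cV[R]_n.+1)) = 0 ->
  {ae P, forall w, nu (boundary (preim_mx (A w) B)) = 0}.
Proof.
move=> B0.
have mB := measurable_nu_preim (borel_boundary (B : set 'cV[R]_n.+1)).
have gint :
    \int[P]_w `|nu (preim_mx (A w) (boundary (B : set 'cV[R]_n.+1)))| = 0.
  by rewrite -[RHS]B0; apply: eq_integral => w _; rewrite gee0_abs.
have := (ae_eq_integral_abs P measurableT mB).1 gint.
have := tau_mx_ae; apply: filterS2 => w w0 /(_ I).
by rewrite boundary_preim_mx// tau_mx_unit.
Qed.

End Breiman.

(** * Construction of the limit measure and quotients of limits *)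

Section Image.
Context {R : realType} {d1 d2 : measure_display}
  {T1 : measurableType d1} {T2 : measurableType d2}.

Lemma pushforward_measure_ex (m : {measure set T1 -> \bar R}) (f : T1 -> T2) :
  measurable_fun setT f ->
  exists m' : {measure set T2 -> \bar R}, forall B, m' B = m (f @^-1` B).
Proof.
move=> mf; unshelve eexists (pushforward m f); [exact: mf|by []].
Qed.

End Image.

Section QuotientLimit.
Context {R : realType}.

(** Divide numerator and denominator by [p]; since [r != 0], the denominator is eventually
    nonzero. *)
Lemma cvg_ratio (a b p : R -> \bar R) (l r : R) :
  (forall x, a x \is a fin_num) -> (forall x, b x \is a fin_num) ->
  (forall x, p x \is a fin_num) -> (forall x, 0 < p x) -> r != 0%R ->
  a x / p x @[x --> +oo%R] --> l%:E -> b x / p x @[x --> +oo%R] --> r%:E ->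
  a x / b x @[x --> +oo%R] --> (l / r)%:E.
Proof.
move=> fa fb fp p0 r0 /fine_cvg al /fine_cvg bl.
have p_neq0 x : fine (p x) != 0%R by rewrite fine_eq0// gt_eqF.
have E x c : c \is a fin_num -> fine (c / p x) = (fine c / fine (p x))%R.
  by move=> fc; rewrite -{1}(fineK fc) -{1}(fineK (fp x)) dive_EFin.
have bnz : \forall x \near +oo%R, fine (b x / p x) != 0%R.
  exact: (cvgr_neq0 _ bl r0).
have h : (fine (a x / p x) / fine (b x / p x))%R @[x --> +oo%R] --> (l / r)%R.
  by apply: cvgM => //; apply: cvgV.
have hE :
    (fine (a x / p x) / fine (b x / p x))%:E @[x --> +oo%R] --> (l / r)%:E.
  by apply: cvg_EFin => //; apply: nearW.
apply: cvg_trans hE; apply: near_eq_cvg; apply: filterS bnz => x.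
rewrite !E// => bx; have b_neq0 : fine (b x) != 0%R.
  by apply: contraNneq bx => ->; rewrite mul0r.
rewrite -[in RHS](fineK (fa x)) -[in RHS](fineK (fb x)) dive_EFin//.
by congr (_%:E); rewrite invf_div mulrA divfK.
Qed.

End QuotientLimit.

Section LimitMeasure.
Context {R : realType} {disp : measure_display} {T : measurableType disp}.
Context (P : probability T R) {n : nat}.
Variables (A : {RV P >-> borel 'M[R]_n.+1})
  (nu : {measure set (borel 'cV[R]_n.+1) -> \bar R}).

(** Realising the mean as the image of a product measure gives sigma-additivity for free; [mrestr]
    then makes the complement of the orthant null. *)
Lemma mean_preim_measure_ex (c : R) : (0 <= c)%R -> sigma_finite setT nu ->
  exists mu : {measure set (borel 'cV[R]_n.+1) -> \bar R},
    orthant_measure mu /\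
    forall B : set (borel 'cV[R]_n.+1), measurable B -> B `<=` orthant ->
      mu B = c%:E * mean_preim P A nu B.
Proof.
move=> c0 snu; have [nu' nuE] := sigma_finite_measure_ex snu.
have mg : measurable_fun setT (fun p : T * borel 'cV[R]_n.+1 =>
    (A p.1 : 'M[R]_n.+1) *m (p.2 : 'cV[R]_n.+1) : borel 'cV[R]_n.+1)%R.
  apply: (measurableT_comp (@measurable_mulmx R n.+1 n.+1 1)
    (measurable_fun_pair _ _)) => /=; last exact: measurable_snd.
  exact: (measurableT_comp _ measurable_fst).
have [m mE] := pushforward_measure_ex (P \x nu') mg.
exists (mscale (NngNum c0) (mrestr m (@measurable_orthant R n))); split.
  by rewrite /orthant_measure/= /mscale/= /mrestr setICl measure0 mule0.
move=> B mB Bo; rewrite /= /mscale/= /mrestr setIidl// mE; congr (_ * _).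
rewrite /= /product_measure1; apply: eq_integral => w _ /=; rewrite nuE.
congr (nu _).
by apply/seteqP; split=> z /=; rewrite /xsection/= inE.
Qed.

End LimitMeasure.

Theorem theorem2p3 (R : realType) (disp : measure_display)
    (T : measurableType disp) (P : probability T R) (n : nat)
    (Z : {RV P >-> borel 'cV[R]_n.+1}) (A : {RV P >-> borel 'M[R]_n.+1})
    (nu : {measure set (borel 'cV[R]_n.+1) -> \bar R}) (alpha delta : R)
    (alpha_gt0 : (0 < alpha)%R)
    (Z_rv : regularly_varying_index P Z nu (- alpha)%R)
    (A_Z_indep : independent_rv A Z)
    (tauA_gt0 : {ae P, forall w, 0 < tau_mx (A w)})
    (delta_gt0 : (0 < delta)%R)
    (tauA_moment : \int[P]_w (tau_mx (A w) `^ (alpha + delta)) < +oo) :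
  (forall B : set (borel 'cV[R]_n.+1),
     measurable B -> B `<=` orthant -> bounded_away_boundary B ->
     \int[P]_w nu (boundary (preim_mx (A w) B)) = 0 ->
     P [set w | scale_set x B (A w *m Z w)%R] / P [set w | (x < minv (Z w))%R]
       @[x --> +oo%R] --> mean_preim P A nu B /\
     mean_preim P A nu B < +oo) /\
  (mean_preim P A nu (upper_orthant 1) != 0 ->
   exists mu : {measure set (borel 'cV[R]_n.+1) -> \bar R},
     (forall B : set (borel 'cV[R]_n.+1), measurable B -> B `<=` orthant ->
        mu B = mean_preim P A nu B / mean_preim P A nu (upper_orthant 1)) /\
     regularly_varying_index P (fun w => (A w *m Z w)%R) mu (- alpha)%R).
Proof.
have part1 (B : set (borel 'cV[R]_n.+1)) (e : R) : measurable B -> (0 < e)%R ->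
    B `<=` upper_orthant e ->
    {ae P, forall w, nu (boundary (preim_mx (A w) B)) = 0} ->
    P [set w | scale_set x B (A w *m Z w)%R] / P [set w | (x < minv (Z w))%R]
      @[x --> +oo%R] --> mean_preim P A nu B.
  exact: (breiman_limit alpha_gt0 Z_rv A_Z_indep tauA_gt0 delta_gt0
    tauA_moment).
have fin (B : set (borel 'cV[R]_n.+1)) (e : R) : measurable B -> (0 < e)%R ->
    B `<=` upper_orthant e -> mean_preim P A nu B < +oo.
  exact: (mean_preim_lty alpha_gt0 Z_rv tauA_gt0 delta_gt0 tauA_moment).
split=> [B mB Bo Bb B0|c0].
  have [e e0 Be] := orthant_bounded_away Bo Bb; split; last exact: fin mB e0 Be.
  apply: (part1 B e) => //.
  exact: (boundary_preim_ae alpha_gt0 Z_rv tauA_gt0 delta_gt0 tauA_moment B0).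
have [r r0 rE] : exists2 r : R, (0 < r)%R &
    mean_preim P A nu (upper_orthant 1) = r%:E.
  have := fin _ _ (measurable_upper_orthant 1) ltr01 (@subset_refl _ _).
  have : 0 <= mean_preim P A nu (upper_orthant 1) by exact: integral_ge0.
  case: (mean_preim P A nu (upper_orthant 1)) c0 => // r r_neq0; exists r => //.
  by rewrite lt_neqAle eq_sym -eqe r_neq0 -lee_fin.
have [[_ nu_orthant _ nu_fin _] _] := Z_rv.
have [|mu [mu_orthant muE]] := mean_preim_measure_ex A (c := r^-1%R) _
  (orthant_sigma_finite nu_orthant nu_fin).
  by rewrite invr_ge0 ltW.
have upperS x : (0 < x)%R -> @upper_orthant R n x `<=` orthant.
  by move=> x0; exact/upper_orthantS/ltW.
have mu1 : mu (upper_orthant 1) = 1.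
  rewrite muE ?rE//; last exact: upperS.
    by rewrite -EFinM mulVf// gt_eqF.
  exact: measurable_upper_orthant.
have mu_homog : homogeneous mu (- alpha)%R.
  move=> t B t0 mB Bo; rewrite !muE//; last 2 first.
  - exact: measurable_scale_set.
  - move=> _ [z Bz <-] i; rewrite mxE mulr_gt0//; exact: Bo.
  rewrite (mean_preim_scale alpha_gt0 Z_rv tauA_gt0 delta_gt0 tauA_moment)//.
  by rewrite muleCA.
have mAZ : measurable_fun setT
    (fun w => (A w : 'M[R]_n.+1) *m (Z w : 'cV[R]_n.+1) : borel 'cV[R]_n.+1)%R.
  exact: (measurableT_comp (@measurable_mulmx R n.+1 n.+1 1)
    (measurable_fun_pair (measurable_funPT A) (measurable_funPT Z))).
exists mu; split.
  by move=> B mB Bo; rewrite muE// rE inver gt_eqF// muleC.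
split=> //; split=> //.
- apply: contraPneq mu1 => muO mu1.
  have : mu (upper_orthant 1) <= mu orthant.
    apply: le_measure; rewrite ?inE; last exact: upperS.
      exact: measurable_upper_orthant.
    exact: measurable_orthant.
  by rewrite muO mu1 lee_fin ler10.
- move=> x x0; rewrite muE; [|exact: measurable_upper_orthant|exact: upperS].
  rewrite lte_mul_pinfty ?lee_fin ?invr_ge0 ?(ltW r0)//.
  exact: fin (measurable_upper_orthant x) x0 (@subset_refl _ _).
move=> B mB Bo Bb B0; have [e e0 Be] := orthant_bounded_away Bo Bb.
(* The formula for [mu] holds only inside the orthant, so the boundary of [C] must be kept there: it
   lies above level [s / 2]. *)
have bd0 (C : set (borel 'cV[R]_n.+1)) (s : R) : (0 < s)%R ->
    C `<=` upper_orthant s -> mu (boundary (C : set 'cV[R]_n.+1)) = 0 ->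
    {ae P, forall w, nu (boundary (preim_mx (A w) C)) = 0}.
  move=> s0 Cs C0.
  apply: (mean_preim_boundary_ae alpha_gt0 Z_rv tauA_gt0 delta_gt0 tauA_moment).
  move: C0; rewrite muE; last 2 first.
  - exact: borel_boundary.
  - have s2 : (s / 2 < s)%R by rewrite ltr_pdivrMr// ltr_pMr// ltr1n.
    apply: subset_trans (boundary_upper_orthant_sub s2 Cs) _.
    by apply: upperS; rewrite divr_gt0.
  by move=> /eqP; rewrite mule_eq0 eqe invr_eq0 gt_eqF//= => /eqP.
have lim1 := part1 B e mB e0 Be (bd0 B e e0 Be B0).
have mu_bd1 : mu (boundary (upper_orthant 1)) = 0.
  by apply: homogeneous_boundary alpha_gt0 mu_homog _ ltr01; rewrite mu1 ltry.
have lim2 := part1 (upper_orthant 1) 1%R (measurable_upper_orthant 1) ltr01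
  (@subset_refl _ _) (bd0 _ _ ltr01 (@subset_refl _ _) mu_bd1).
have [m mE] : exists m : R, mean_preim P A nu B = m%:E.
  have := fin B e mB e0 Be.
  have : 0 <= mean_preim P A nu B by exact: integral_ge0.
  by case: (mean_preim P A nu B) => // m; exists m.
have -> : mu B = (m / r)%:E by rewrite muE// mE mulrC.
rewrite mE in lim1; rewrite rE in lim2.
(* [cvg_ratio] asks for finiteness at every [x], while measurability of the dilated set is known
   only for positive factors; the truncation at 1 does not affect the limit. *)
pose a x := P [set w | scale_set (Num.max x 1%R) B (A w *m Z w)%R].
pose b x :=
  P [set w | scale_set (Num.max x 1%R) (upper_orthant 1) (A w *m Z w)%R].
pose p x := P [set w | (x < minv (Z w))%R].
have max0 x : (0 < Num.max x 1 :> R)%R by rewrite lt_max ltr01 orbT.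
have mpre (C : set (borel 'cV[R]_n.+1)) : measurable C ->
    measurable [set w | C (A w *m Z w)%R].
  by move=> mC; rewrite -[X in measurable X]setTI; exact: mAZ.
have xmax : \forall x \near +oo%R, (Num.max x 1 = x :> R)%R.
  by apply: filterS (nbhs_pinfty_ge (num_real 1)) => x /max_idPl.
have : a x / b x @[x --> +oo%R] --> (m / r)%:E.
  apply: (@cvg_ratio R a b p) => //.
  - move=> x; apply: fin_num_measure; apply: mpre; exact: measurable_scale_set.
  - move=> x; apply: fin_num_measure; apply: mpre.
    apply: measurable_scale_set => //; exact: measurable_upper_orthant.
  - move=> x; apply: fin_num_measure; rewrite minv_tailE.
    rewrite -[X in measurable X]setTI; apply: measurable_funP => //.
    exact: measurable_upper_orthant.
  - by move=> x; rewrite /p minv_tailE; exact: rv_tail_gt0 alpha_gt0 Z_rv x.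
  - by rewrite gt_eqF.
  - apply: cvg_trans lim1; apply: near_eq_cvg.
    by apply: filterS xmax => x xE; rewrite /a xE.
  - apply: cvg_trans lim2; apply: near_eq_cvg.
    by apply: filterS xmax => x xE; rewrite /b xE.
apply: cvg_trans; apply: near_eq_cvg.
apply: filterS2 xmax (nbhs_pinfty_ge (num_real 1)) => x xE x1.
rewrite /a /b xE minv_tailE scale_upper_orthant ?mulr1//.
exact: lt_le_trans x1.
Qed.
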